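(* Let $\Gamma$ be a set, let $\lambda:\Gamma\to\Gamma$ be a function such that $\lambda^{-1}(i)$ is finite for every $i\in\Gamma$, let $K$ be a non-trivial finite abelian group, and consider the generalized shift $\sigma_\lambda:K^{(\Gamma)}\to K^{(\Gamma)}$, $(x_i)_{i\in\Gamma}\mapsto (x_{\lambda(i)})_{i\in\Gamma}$. Then $$\mathrm{ent}(\sigma_\lambda)=|s_\lambda|^*\log|K|.$$
   Context: $K^{(\Gamma)}=\bigoplus_{i\in\Gamma}K$ is the direct sum of copies of $K$ indexed by $\Gamma$; since $\lambda$ has finite fibers, $(x_i)_{i\in\Gamma}\mapsto(x_{\lambda(i)})_{i\in\Gamma}$ is a well-defined endomorphism of $K^{(\Gamma)}$. Algebraic entropy: for an endomorphism $\phi$ of an abelian group $G$, a finite subgroup $F\le G$ and $n\in\mathbb N=\{1,2,\dots\}$, put $T_n(\phi,F)=F+\phi(F)+\dots+\phi^{n-1}(F)$, $H(\phi,F)=\lim_{n\to+\infty}\frac{\log|T_n(\phi,F)|}{n}$, and $\mathrm{ent}(\phi)=\sup\{H(\phi,F): F \text{ a finite subgroup of } G\}\in[0,+\infty]$. A string of $\lambda$ is an infinite sequence $S=\{m_t\}_{t\in\{0,-1,-2,\dots\}}$ of pairwise distinct elements of $\Gamma$ such that $\lambda(m_t)=m_{t+1}$ for every $t\in\{-1,-2,\dots\}$. The string number of $\lambda$ is $s_\lambda=\sup\{|\mathcal F|:\mathcal F \text{ a family of pairwise disjoint strings of }\lambda\}$ (a cardinal). $|s_\lambda|^*$ denotes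 $s_\lambda$ if $s_\lambda$ is finite, and $+\infty$ if $s_\lambda$ is infinite; $(+\infty)\cdot\log|K|=+\infty$. *)

(* Defs.v *)
From HB Require Import structures.
From mathcomp Require Import all_boot all_order all_algebra finmap.
From mathcomp Require Import all_classical all_reals all_analysis.

Set Implicit Arguments.
Unset Strict Implicit.
Unset Printing Implicit Defensive.

Import Order.TTheory GRing.Theory Num.Theory.
Import numFieldNormedType.Exports.

Local Open Scope classical_set_scope.
Local Open Scope ring_scope.
Local Open Scope card_scope.

Section DirectSum.
Variables (I : Type) (M : zmodType).

Definition supp (x : I -> M) : set I := [set i | x i != 0].

Definition fin_supp : {pred I -> M} := fun x => `[< finite_set (supp x) >].

Lemma fin_supp_zmod_closed : zmod_closed fin_supp.
Proof.
split=> [|x y /asboolP xfin /asboolP yfin]; apply/asboolP.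
  by rewrite (_ : supp 0 = set0) // -subset0 => i; rewrite /supp /= eqxx.
have xyfin : finite_set (supp x `|` supp y) by rewrite finite_setU.
apply: sub_finite_set xyfin => i; rewrite /supp /=.
have -> : (x - y) i = x i - y i by [].
have [xi0|] := eqVneq (x i) 0; last by left.
have [yi0|] := eqVneq (y i) 0; last by right.
by rewrite xi0 yi0 subr0 eqxx.
Qed.

HB.instance Definition _ :=
  GRing.isZmodClosed.Build (I -> M) fin_supp fin_supp_zmod_closed.

(* The direct sum of copies of M indexed by I: the finitely supported
   functions, as a subgroup of the group of all functions I -> M. *)
Record dsum := DSum { dsum_fun :> I -> M; dsum_fin : fin_supp dsum_fun }.

HB.instance Definition _ := [isSub for dsum_fun].
HB.instance Definition _ := [Choice of dsum by <:].
HB.instance Definition _ := [SubChoice_isSubZmodule of dsum by <:].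

End DirectSum.

Section GeneralizedShift.
Variables (I : Type) (M : zmodType) (lam : I -> I).
Hypothesis lam_fin : forall i, finite_set (lam @^-1` [set i]).

Lemma fin_supp_comp (x : I -> M) :
  fin_supp x -> fin_supp (fun i => x (lam i)).
Proof.
move=> /asboolP xfin; apply/asboolP.
have /sub_finite_set : supp (fun i => x (lam i)) `<=`
    \bigcup_(j in supp x) (lam @^-1` [set j]) by move=> i xi; exists (lam i).
by apply; exact: bigcup_finite.
Qed.

Definition gshift (x : dsum I M) : dsum I M :=
  DSum (fin_supp_comp (dsum_fin x)).

Lemma gshift_is_zmod_morphism : zmod_morphism gshift.
Proof. by move=> x y; apply/val_inj. Qed.

HB.instance Definition _ := GRing.isZmodMorphism.Build
  (dsum I M) (dsum I M) gshift gshift_is_zmod_morphism.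

End GeneralizedShift.

Arguments gshift {I} M {lam} lam_fin x.

Section AlgebraicEntropy.
Variables (R : realType) (G : zmodType) (phi : {additive G -> G}).

Definition finite_subgroup (F : set G) : Prop :=
  finite_set F /\ zmod_closed [in F].

Definition trajectory (F : set G) (n : nat) : set G :=
  [set \sum_(k < n) iter k phi (x k) |
    x in [set x : 'I_n -> G | forall k, F (x k)]].

Definition trajectory_entropy (F : set G) : R :=
  limn (fun n => ln (#|` fset_set (trajectory F n)|%:R : R) / n%:R).

Definition ent : \bar R :=
  ereal_sup [set (trajectory_entropy F)%:E | F in finite_subgroup].

End AlgebraicEntropy.

Section CardinalSup.

(* Cardinals are represented by sets up to equinumerosity [#=], ordered by
   [#<=].  The least upper bound is taken among all cardinals, not only those
   of subsets of U. *)
Definition is_card_sup (U : Type) (C : set (set U)) (s : set U) : Prop :=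
  (forall A, C A -> A #<= s) /\
  (forall (T : Type) (B : set T), (forall A, C A -> A #<= B) -> s #<= B).

(* A set whose cardinality is the supremum of the cardinalities of the members
   of C; well defined up to [#=] by [card_supP]. *)
Definition card_sup (U : Type) (C : set (set U)) : set U :=
  get (is_card_sup C).

Lemma card_le_of_inj (T U : Type) (A : set T) (B : set U) (f : T -> U) :
  (forall x, A x -> B (f x)) ->
  (forall x y, A x -> A y -> f x = f y -> x = y) -> A #<= B.
Proof.
move=> fAB finj; have /inj_card_eq : {in A &, injective f}.
  by move=> x y; rewrite !inE; exact: finj.
rewrite card_eq_le => /andP[_ /card_le_trans]; apply.
by apply: subset_card_le => _ [x Ax <-]; exact: fAB.
Qed.

Lemma card_le_min (U : Type) (C : set (set U)) : C !=set0 ->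
  exists2 A, C A & forall B, C B -> A #<= B.
Proof.
move=> [A0 CA0].
pose P (X : set (set U -> U)) :=
  (forall f A, X f -> C A -> A (f A)) /\
  (forall f g A, X f -> X g -> C A -> f A = g A -> f = g).
have [|X [[XC Xinj] Xmax]] := @Zorn_bigcup _ P.
  move=> F FP Ftot; split=> [f A [X FX Xf]|f g A [X FX Xf] [Y FY Yg]].
    exact: (FP _ FX).1.
  have [XY|YX] := Ftot _ _ FX FY.
    by apply: (FP _ FY).2 => //; exact: XY.
  by apply: (FP _ FX).2 => //; exact: YX.
have [A CA AX] : exists2 A, C A & forall a, A a -> exists2 f, X f & f A = a.
  apply: contrapT => noA.
  have /choice[g gP] A : exists a, C A -> A a /\ forall f, X f -> f A <> a.
    have [CA|nCA] := pselect (C A); last first.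
      have [[a _]|noa] := pselect (exists a, A0 a); first by exists a.
      exfalso; apply: noA; exists A0 => // a A0a; exfalso; apply: noa.
      by exists a.
    apply: contrapT => noa; apply: noA; exists A => // a Aa.
    apply: contrapT => nof; apply: noa; exists a => _; split=> // f Xf fAa.
    by apply: nof; exists f.
  have nXg : ~ X g by move=> Xg; exact: ((gP _ CA0).2 _ Xg).
  apply: (Xmax (X `|` [set g])).
    by split=> [f Xf|XgX]; [left | apply/nXg/XgX; right].
  split=> [f B [Xf|->] CB|f h B [Xf|->] [Xh|->] CB e //].
  - exact: (XC f B Xf CB).
  - by case: (gP _ CB).
  - exact: Xinj e.
  - by case: ((gP _ CB).2 _ Xf e).
  - by case: ((gP _ CB).2 _ Xh (esym e)).
exists A => // B CB.
have /choice[f fP] a : exists f, A a -> X f /\ f A = a.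
  have [Aa|nAa] := pselect (A a); last by exists (fun=> a).
  by have [f Xf fA] := AX _ Aa; exists f.
apply: (@card_le_of_inj _ _ _ _ (fun a => f a B)) => [a Aa|a b Aa Ab fab].
  by apply: XC CB; exact: (fP _ Aa).1.
have [[Xfa <-] [Xfb <-]] := (fP _ Aa, fP _ Ab).
by rewrite (Xinj _ _ _ Xfa Xfb CB fab).
Qed.

Lemma card_le_total (T U : Type) (A : set T) (B : set U) :
  A #<= B \/ B #<= A.
Proof.
pose A' : set (T + U) := inl @` A; pose B' : set (T + U) := inr @` B.
have /andP[AA' A'A] : (A #<= A') && (A' #<= A).
  by rewrite -card_eq_le card_eq_sym; apply: inj_card_eq => x y _ _ [].
have /andP[BB' B'B] : (B #<= B') && (B' #<= B).
  by rewrite -card_eq_le card_eq_sym; apply: inj_card_eq => x y _ _ [].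
have [|D D2 Dmin] := @card_le_min _ [set A'; B']; first by exists A'; left.
have [DA DB] := (Dmin A' (or_introl erefl), Dmin B' (or_intror erefl)).
case: D2 DA DB => -> DA DB; [left | right].
  exact: card_le_trans AA' (card_le_trans DB B'B).
exact: card_le_trans BB' (card_le_trans DA A'A).
Qed.

Lemma card_supP (U : Type) (C : set (set U)) : is_card_sup C (card_sup C).
Proof.
suff [s sP] : exists s, is_card_sup C s by exact: (@getI _ _ s).
pose ub (B : set U) := forall A, C A -> A #<= B.
have [|s sub smin] := @card_le_min _ ub.
  by exists setT => A _; exact: card_leT.
exists s; split=> // T B Bub.
have [UB|BU] := card_le_total [set: U] B.
  exact: card_le_trans (card_leT s) UB.
have [B' B'B] : exists B' : set U, B' #= B.
  have /card_leP[f] := BU; exists (range (fun b => val (f b))).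
  rewrite -(card_eqr (card_setT B)); apply: inj_card_eq => x y _ _ /val_inj.
  by apply: inj; rewrite inE.
have /andP[B'leB BleB'] : (B' #<= B) && (B #<= B') by rewrite -card_eq_le.
by apply: card_le_trans B'leB; apply: smin => A /Bub /card_le_trans; apply.
Qed.

End CardinalSup.

Section StringNumber.
Variables (I : Type) (lam : I -> I).

(* The string (m_t), t = 0, -1, -2, ..., is encoded by m n := m_{-n}. *)
Definition is_string (m : nat -> I) : Prop :=
  injective m /\ forall n, lam (m n.+1) = m n.

Definition disjoint_strings (F : set (nat -> I)) : Prop :=
  F `<=` is_string /\ trivIset F (fun m => range m).

Definition string_number : set (nat -> I) := card_sup disjoint_strings.

End StringNumber.

(* The operation |s|^* turning a cardinal into an extended real. *)
Definition card_star (R : realType) (T : Type) (s : set T) : \bar R :=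
  if `[< finite_set s >]
  then (#|` fset_set (s : set {classic T})|%:R)%:E
  else +oo%E.

(* Main.v *)
Require Import Defs.
From mathcomp Require Import all_boot all_order all_algebra finmap.
From mathcomp Require Import zify.
From mathcomp Require Import all_classical all_reals all_analysis.

Set Implicit Arguments.
Unset Strict Implicit.
Unset Printing Implicit Defensive.

Import Order.TTheory GRing.Theory Num.Theory.
Import numFieldNormedType.Exports.

Local Open Scope classical_set_scope.
Local Open Scope ring_scope.
Local Open Scope card_scope.

(** The [t]-th iterate of the shift sends [x] to [i |-> x (lam^t i)], so an
element of the trajectory of [F] up to time [n] is a function
[i |-> \sum_(t < n) x_t (lam^t i)] with all [x_t] in [F].  Both inequalities
come from reading off such a function along orbits of [lam].

Upper bound.  The supports of the elements of a finite subgroup [F] lie in a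
finite set [A].  If the orbit of [i] first meets [A] at time [r] < [n], in the
point [a], then the value at [i] of an element of the trajectory only depends
on the pair [(r, a)]; if it does not meet [A] before time [n], the value is
[0].  Hence the trajectory has at most [#|K| ^ p] elements, where [p] is the
number of pairs [(r, a)] that occur as such a first hit with [r < n].  Call
[a] live when it is first hit at every time [r].  A point that is not live
accounts for boundedly many pairs, a live one for at most [n], so [p] is at
most [n] times the number of live points plus a constant.  By the König
argument of [first_hit_string], a live point [a] starts a backward orbit whose
later terms avoid [A].  This orbit is injective, hence a string, and the
strings of distinct live points are disjoint, because [A] is met only at their
starting points.  So there are at most as many live points as disjoint
strings ([trajectory_card_le]), and dividing logarithms by [n] bounds the
entropy of [F] ([trajectory_entropy_le]).

Lower bound.  Given disjoint strings [m_1, ..., m_k], let [F] consist of the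
functions supported in [{m_1 0, ..., m_k 0}].  The coefficients of an element
of the trajectory are recovered, from the latest time to the earliest, by
evaluating it at the points [m_j r], so the trajectory up to time [n] has
exactly [#|K| ^ (n * k)] elements ([string_system_entropy]).

Since the string number is a supremum of cardinals, a finite [k] is at most
the string number exactly when there are [k] disjoint strings
([string_system_card], [string_system_exists]).  The two bounds then give the
formula, with infinite entropy when [k] is unbounded. *)

(** * Finite families of disjoint strings *)

Lemma card_le_I_total (T : Type) (A : set T) (k : nat) :
  `I_k.+1 #<= A \/ A #<= `I_k.
Proof.
have [/finite_setP[n An]|/infiniteP NA] := pselect (finite_set A); last first.
  by left; apply: card_le_trans (card_leT _) NA.
have [nk|kn] := leqP n k; [right|left].
  by rewrite (card_le_eql An) card_le_II.
by rewrite (card_le_eqr An) card_le_II.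
Qed.

(** A family of pairwise disjoint strings indexed by [J].  As strings are
nonempty, the second clause also makes the family injective, so that it has as
many members as [J] has elements. *)
Definition string_system (I J : Type) (lam : I -> I) (m : J -> nat -> I) :=
  (forall j, is_string lam (m j)) /\
  (forall j l p q, m j p = m l q -> j = l).

Lemma string_system_card (I : Type) (lam : I -> I) (J : finType)
    (m : J -> nat -> I) :
  string_system lam m -> `I_#|J| #<= string_number lam.
Proof.
move=> [mstr mdisj].
have minj : injective m by move=> j l e; apply: (mdisj j l 0%N 0%N); rewrite e.
have [sup _] := card_supP (disjoint_strings lam).
apply: card_le_trans (sup (range m) _).
  rewrite (card_le_eql card_II).
  apply: (@card_le_of_inj _ _ _ _ (fun j => m (enum_val j))) => [j _|j l _ _].
    by exists (enum_val j).
  by move/minj/enum_val_inj.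
split=> [_ [j _ <-] //|_ _ [j _ <-] [l _ <-] [_ [[p _ <-] [q _ e]]]].
by rewrite (mdisj _ _ _ _ e).
Qed.

(** A supremum of cardinals that is at least [k.+1] cannot be a bound of families
all of which have at most [k] members: a finite lower bound on the string
number is attained. *)
Lemma string_system_exists (I : Type) (lam : I -> I) (k : nat) :
  `I_k #<= string_number lam ->
  exists m : 'I_k -> nat -> I, string_system lam m.
Proof.
move=> ks; have [A [Astr Adisj] kA] :
    exists2 A, disjoint_strings lam A & `I_k #<= A.
  case: k ks => [_|k ks].
    exists set0; last by rewrite II0.
    by split=> // i j [].
  apply: contrapT => noA.
  suff : `I_k.+1 #<= `I_k by rewrite card_le_II ltnn.
  apply: card_le_trans ks _; have [_] := card_supP (disjoint_strings lam).
  apply=> A CA; have [kA|//] := card_le_I_total A k.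
  by case: noA; exists A.
have /card_leP[f] := kA.
have ltk (j : 'I_k) : (j : nat) \in `I_k by rewrite inE /=.
pose m j := val (f (SigSub (ltk j))).
have mA j : A (m j) by rewrite /m; case: (f _) => x /=; rewrite inE.
have minj : injective m.
  by move=> j l /val_inj /(@inj _ _ _ f); rewrite !inE => /(_ Logic.I Logic.I)[/val_inj].
exists m; split=> [j|j l p q e]; first exact: Astr (mA j).
by apply/minj/Adisj => //; exists (m j p); split; [exists p | rewrite e; exists q].
Qed.

(** * Backward König argument *)

(** Only used for [x] in [A]: the orbit of [i] then enters [A] for the first time
after [r] steps, at [x]. *)
Definition first_hit (I : Type) (lam : I -> I) (A : set I) (r : nat) (x i : I) :=
  iter r lam i = x /\ forall t, (t < r)%N -> ~ A (iter t lam i).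

Lemma first_hit_iter (I : Type) (lam : I -> I) (A : set I) r s x i :
  (s <= r)%N -> first_hit lam A r x i ->
  first_hit lam A s x (iter (r - s) lam i).
Proof.
move=> sr [xE nA]; split=> [|t ts]; first by rewrite -iterD subnKC.
by rewrite -iterD; apply: nA; lia.
Qed.

(** The step of the König argument: if every preimage [y] of [x] outside [A]
failed to be hit at some time [b y], then, the fiber being finite, [x] could
not be hit at a time beyond all the [b y]. *)
Lemma first_hit_pred (I : Type) (lam : I -> I) (A : set I) x :
  finite_set (lam @^-1` [set x]) ->
  (forall r, exists i, first_hit lam A r x i) ->
  exists y, [/\ lam y = x, ~ A y & forall r, exists i, first_hit lam A r y i].
Proof.
move=> xfin xhit; apply: contrapT => noy.
have /choice[b bP] y : exists r, lam y = x -> ~ A y ->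
    forall i, ~ first_hit lam A r y i.
  apply: contrapT => nob; apply: noy; exists y.
  have yx : lam y = x by apply: contrapT => n; apply: nob; exists 0%N.
  have nAy : ~ A y by move=> Ay; apply: nob; exists 0%N => _ /(_ Ay).
  split=> // r; apply: contrapT => nor; apply: nob; exists r => _ _ i hi.
  by apply: nor; exists i.
pose B := (\max_(r <- fset_set (b @` (lam @^-1` [set x]))) r)%N.
have bB y : lam y = x -> (b y <= B)%N.
  move=> yx; apply: (@leq_bigmax_seq _ _ xpredT id) => //.
  rewrite in_fset_set; last exact: finite_image.
  by rewrite inE; exists y.
have [i [iE inA]] := xhit B.+1.
have yx : lam (iter B lam i) = x by rewrite -iE.
apply: (bP _ yx (inA _ (ltnSn B)) _ (first_hit_iter (bB _ yx) _)).
by split=> // t tB; apply: inA; exact: ltnW.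
Qed.

(** A backward orbit with [m p = m q] and [p < q] would satisfy
[m 0 = m (q - p)], by applying [lam] [p] times.  This is impossible here since
[m 0] lies in [A] while the later terms do not, so the backward orbit built
from [first_hit_pred] is automatically a string, even for a periodic [x]. *)
Lemma first_hit_string (I : Type) (lam : I -> I) (A : set I) x :
  (forall i, finite_set (lam @^-1` [set i])) ->
  A x -> (forall r, exists i, first_hit lam A r x i) ->
  exists m : nat -> I, [/\ m 0%N = x, is_string lam m & forall n, ~ A (m n.+1)].
Proof.
move=> lam_fin Ax xhit; pose live y := forall r, exists i, first_hit lam A r y i.
have /choice[g gP] y : exists z, live y -> [/\ lam z = y, ~ A z & live z].
  have [yl|nyl] := pselect (live y); last by exists y.
  by have [z zP] := first_hit_pred (lam_fin y) yl; exists z.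
pose m n := iter n g x.
have ml n : live (m n) by elim: n => // n /gP[].
have mS n : lam (m n.+1) = m n by have [] := gP _ (ml n).
have nA n : ~ A (m n.+1) by have [] := gP _ (ml n).
have shift p d : m d = iter p lam (m (p + d)%N).
  by elim: p => // p IH; rewrite iterSr addSn mS.
exists m; split=> //; split=> //.
suff lem p q : (p <= q)%N -> m p = m q -> p = q.
  by move=> p q e; have [/lem|/ltnW/lem/(_ (esym e))] := leqP p q; [apply|].
move=> pq e; have := shift p 0%N; rewrite addn0 e -{1}(subnKC pq) -shift.
case: (q - p)%N (subnKC pq) => [|d _ xE]; first by rewrite addn0.
by case: (nA d); rewrite -xE.
Qed.

(** * Counting the trajectory of a finite subgroup *)

Lemma card_fset_set_le (T : choiceType) (X : finType) (A : set T) (f : T -> X) :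
  (forall x y, A x -> A y -> f x = f y -> x = y) ->
  (#|` fset_set A| <= #|X|)%N.
Proof.
move=> finj; apply: geq_card_fset_set.
apply: (@card_le_of_inj _ _ _ _ (fun x => enum_rank (f x) : nat)) => [x _ /=|].
  exact: ltn_ord.
by move=> x y Ax Ay /val_inj/enum_rank_inj; exact: finj.
Qed.

Lemma card_fset_set_range (T : choiceType) (X : finType) (f : X -> T) :
  injective f -> #|` fset_set (range f)| = #|X|.
Proof.
move=> finj; apply: card_fset_set.
have -> : range f = range (f \o @enum_val X predT).
  apply/seteqP; split=> _ [x _ <-]; last by exists (enum_val x).
  by exists (enum_rank x) => //=; rewrite enum_rankK.
rewrite (card_eqr card_II); apply: inj_card_eq => i j _ _ /finj.
exact: enum_val_inj.
Qed.

Lemma finite_set_enum (T : Type) (A : set T) : finite_set A ->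
  exists N (a : 'I_N -> T), injective a /\ range a = A.
Proof.
move=> /finite_setP[N]; rewrite card_eq_sym => /card_bijP[f [g fK gK]].
have ltN (j : 'I_N) : (j : nat) \in `I_N by rewrite inE /=.
exists N, (fun j => val (f (SigSub (ltN j)))); split.
  by move=> j l /val_inj/(can_inj fK)[/val_inj].
apply/seteqP; split=> [_ [j _ <-]|x Ax].
  by case: (f _) => x /=; rewrite inE.
pose u := g (SigSub (mem_set Ax)).
have uN : (val u < N)%N by have := set_mem (valP u).
exists (Ordinal uN) => //.
by rewrite (_ : SigSub _ = u) ?gK //; apply/val_inj.
Qed.

Lemma dsum_sumE (I : Type) (M : zmodType) (J : finType) (x : J -> dsum I M) i :
  (\sum_j x j) i = \sum_j x j i.
Proof. by apply: (big_morph (fun y : dsum I M => y i)). Qed.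

Lemma iter_gshiftE (I : Type) (M : zmodType) (lam : I -> I)
    (lam_fin : forall i, finite_set (lam @^-1` [set i])) r (x : dsum I M) i :
  iter r (gshift M lam_fin) x i = x (iter r lam i).
Proof. by elim: r i => // r IH i; rewrite iterS iterSr -IH. Qed.

Lemma trajectoryE (I : Type) (M : zmodType) (lam : I -> I)
    (lam_fin : forall i, finite_set (lam @^-1` [set i])) n
    (x : 'I_n -> dsum I M) i :
  (\sum_(t < n) iter t (gshift M lam_fin) (x t)) i =
  \sum_(t < n) x t (iter t lam i).
Proof. by rewrite dsum_sumE; apply: eq_bigr => t _; rewrite iter_gshiftE. Qed.

(** An element of the trajectory is determined by its values at one point
[rep (r, j)] for each pair of a time [r] and a point [a j] of the support that
occur as a first hit.  With [k] live points, the pairs with [a j] live and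
[r < n] number [k * n]; the other pairs have [r < C], for a bound [C] that does
not depend on [n]. *)
Lemma trajectory_card_le (I : Type) (lam : I -> I)
    (lam_fin : forall i, finite_set (lam @^-1` [set i]))
    (K : finZmodType) (N : nat) (a : 'I_N -> I) (F : set (dsum I K)) :
  injective a -> (forall x i, F x -> x i != 0 -> range a i) ->
  exists k C, `I_k #<= string_number lam /\
    forall n, (#|` fset_set (trajectory (gshift K lam_fin) F n)| <=
               #|K| ^ (n * k + C))%N.
Proof.
move=> ainj Fa; set A := range a in Fa.
have F0 x i : F x -> ~ A i -> x i = 0.
  by move=> Fx; apply: contra_not_eq; exact: Fa.
pose live j := `[< forall r, exists i, first_hit lam A r (a j) i >].
pose J := {j | live j}.
have /choice[m mP] (j : J) : exists m : nat -> I,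
    [/\ m 0%N = a (val j), is_string lam m & forall n, ~ A (m n.+1)].
  by apply: first_hit_string => //; [exists (val j) | exact/asboolP/(valP j)].
have /choice[c cP] j : exists c, ~~ live j ->
    forall r i, first_hit lam A r (a j) i -> (r < c)%N.
  have [lj|/asboolP/existsNP[c nc]] := boolP (live j); first by exists 0%N.
  exists c => _ r i hi; rewrite ltnNge; apply/negP => cr; apply: nc.
  by exists (iter (r - c) lam i); exact: first_hit_iter hi.
pose C := (\max_j c j)%N.
have /choice[rep repP] (p : nat * 'I_N) : exists i,
    (exists i', first_hit lam A p.1 (a p.2) i') -> first_hit lam A p.1 (a p.2) i.
  have [[i hi]|nh] := pselect (exists i', first_hit lam A p.1 (a p.2) i').
    by exists i.
  by exists (a p.2).
exists #|{: J}|, (C * N)%N; split=> [|n].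
  (* Pulling a common point of two of these strings forward until one of them
     reaches its start, in [A], forces the other one to be at its start too. *)
  apply: (@string_system_card _ _ _ m); split=> [j|j l]; first by have [] := mP j.
  have mstr j' : forall p, lam (m j' p.+1) = m j' p by have [_ []] := mP j'.
  suff lem j' l' p q : (p <= q)%N -> m j' p = m l' q -> j' = l'.
    by move=> p q e; have [/lem|/ltnW/lem/(_ (esym e))] := leqP p q; [apply|].
  elim: p q => [|p IH] [|q] //= pq e.
  - have [m0 _ _] := mP j'; have [m0' _ _] := mP l'.
    by apply/val_inj/ainj; rewrite -m0 -m0'.
  - have [m0 _ _] := mP j'; have [_ _ /(_ q)[]] := mP l'.
    by rewrite -e m0; exists (val j').
  - by apply: (IH q) => //; rewrite -(mstr j') -(mstr l') e.
rewrite mulnC.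
have -> : (#|{: J}| * n + C * N = #|{: J * 'I_n + 'I_C * 'I_N}|)%N.
  by rewrite card_sum !card_prod !card_ord.
rewrite -card_ffun; pose at_ (s : J * 'I_n + 'I_C * 'I_N) : I :=
  match s with inl p => rep (p.2 : nat, val p.1)
             | inr p => rep (p.1 : nat, p.2) end.
pose f (y : dsum I K) : {ffun J * 'I_n + 'I_C * 'I_N -> K} :=
  [ffun s => y (at_ s)].
apply: (@card_fset_set_le _ _ _ f).
have same y r x i i' : trajectory (gshift K lam_fin) F n y ->
    first_hit lam A r x i -> first_hit lam A r x i' -> y i = y i'.
  move=> [x' Fx' <-] [ie iA] [i'e i'A]; rewrite !trajectoryE.
  apply: eq_bigr => t _; have [tr|rt] := ltnP t r.
    by rewrite !F0 //; [exact: i'A | exact: iA].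
  by rewrite -(subnK rt) !iterD ie i'e.
have never y i : trajectory (gshift K lam_fin) F n y ->
    (forall t, (t < n)%N -> ~ A (iter t lam i)) -> y i = 0.
  move=> [x' Fx' <-] iA; rewrite trajectoryE big1 // => t _.
  by rewrite F0 //; exact: iA.
move=> y z Ty Tz fyz; apply/val_inj/funext => i /=.
have [[t [tn At]]|nt] := pselect (exists t, (t < n)%N /\ A (iter t lam i));
  last by rewrite !never // => t tn At; apply: nt; exists t.
have exA : exists t, `[< A (iter t lam i) >] by exists t; apply/asboolP.
case: (ex_minnP exA) => r /asboolP[j _ aj] rmin.
have hit : first_hit lam A r (a j) i.
  by split=> // t' t'r At'; have := rmin t' (asboolT At'); rewrite leqNgt t'r.
have rn : (r < n)%N by apply: leq_ltn_trans tn; exact/rmin/asboolP.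
have hrep := repP (r, j) (ex_intro _ i hit).
rewrite (same y _ _ _ _ Ty hit hrep) (same z _ _ _ _ Tz hit hrep).
have [lj|nlj] := boolP (live j).
  have /ffunP/(_ (inl (exist _ j lj, Ordinal rn))) := fyz.
  by rewrite !ffunE.
have rC : (r < C)%N := leq_trans (cP _ nlj _ _ hit) (leq_bigmax j).
have /ffunP/(_ (inr (Ordinal rC, j))) := fyz.
by rewrite !ffunE.
Qed.

(** Dividing logarithms by [n] makes the constant [C] disappear in the limit.
Convergence of the sequence is not assumed: a divergent sequence has limit [0]
by convention, and the bound is nonnegative. *)
Lemma trajectory_entropy_le (R : realType) (G : zmodType)
    (phi : {additive G -> G}) (F : set G) (q k C : nat) : (0 < q)%N ->
  (forall n, (#|` fset_set (trajectory phi F n)| <= q ^ (n * k + C))%N) ->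
  trajectory_entropy R phi F <= k%:R * ln (q%:R : R).
Proof.
move=> q0 Tle; have lnq : 0 <= ln (q%:R : R) by rewrite ln_ge0 // ler1n.
rewrite /trajectory_entropy; set u := (fun n => _).
have [cu|/dvgP ->] := pselect (cvg (u @ \oo)); last exact: mulr_ge0.
apply/ler_addgt0Pr => e e0; apply: limr_le => //; near=> n.
have n0 : 0 < n%:R :> R by rewrite ltr0n; near: n; exact: nbhs_infty_gt.
rewrite /u ler_pdivrMr // (@le_trans _ _ ((n * k + C)%:R * ln q%:R)) //.
  have [->|T0] := posnP #|` fset_set (trajectory phi F n)|.
    by rewrite ln0 // mulr_ge0.
  have qn0 : 0 < q%:R ^+ (n * k + C) :> R by rewrite exprn_gt0 // ltr0n.
  rewrite mulr_natl -lnXn ?ltr0n // ler_ln ?posrE ?ltr0n //.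
  by rewrite -natrX ler_nat.
rewrite natrD natrM !mulrDl [_ * k%:R]mulrC mulrAC lerD2l -ler_pdivrMl //.
by near: n; exact: nbhs_infty_ger.
Unshelve. all: by end_near. Qed.

(** * Disjoint strings generate entropy *)

Lemma dsum_interpolation (J : finType) (T : Type) (M : zmodType)
    (b : J -> T) (c : J -> M) : injective b ->
  exists x : dsum T M, (forall j, x (b j) = c j) /\
    (forall i, x i != 0 -> range b i).
Proof.
move=> binj; pose x i := \sum_(j | `[< b j = i >]) c j.
have xb i : x i != 0 -> range b i.
  apply: contra_neqP => nb; rewrite /x big1 // => j /asboolP ji.
  by case: nb; exists j.
have xfin : fin_supp x.
  by apply/asboolP/(sub_finite_set xb)/finite_image; exact: finite_finset.
exists (DSum xfin); split=> //= j; rewrite /x (big_pred1 j) // => l /=.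
by apply/asboolP/eqP => [/binj|->].
Qed.

(** At the point [m j r], with [b j := m j 0], the term of time [t] of an element
of the trajectory is its coefficient at [(r, j)] if [t = r], and vanishes if
[t < r], since [lam^t (m j r) = m j (r - t)] is then not the start of any of
the strings.  Terms with [t > r] may well contribute, when the forward orbit
of one string runs into another string or into itself.  The system expressing
the coefficients is thus triangular in time, and solved from the latest time
downwards. *)
Lemma string_system_entropy (R : realType) (I : Type) (lam : I -> I)
    (lam_fin : forall i, finite_set (lam @^-1` [set i]))
    (K : finZmodType) (k : nat) (m : 'I_k -> nat -> I) :
  string_system lam m -> exists2 F, finite_subgroup F &
  trajectory_entropy R (gshift K lam_fin) F = k%:R * ln (#|K|%:R : R).
Proof.
move=> [mstr mdisj]; pose b j := m j 0%N.
have binj : injective b by move=> j l; exact: mdisj.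
pose F := [set x : dsum I K | forall i, x i != 0 -> range b i].
have F_ext x y : F x -> F y -> (forall j, x (b j) = y (b j)) -> x = y.
  move=> Fx Fy xy; apply/val_inj/funext => i /=.
  have [[j _ <-] //|nb] := pselect (range b i).
  by rewrite (contra_not_eq (Fx i) nb) (contra_not_eq (Fy i) nb).
exists F.
  split.
    apply: (@card_le_finite _ _ F [set: {ffun 'I_k -> K}]) => //.
    pose f (x : dsum I K) : {ffun 'I_k -> K} := [ffun j => x (b j)].
    apply: (@card_le_of_inj _ _ _ _ f) => // x y.
    by move=> Fx Fy /ffunP xy; apply: F_ext => // j; have := xy j; rewrite !ffunE.
  split=> [|x y]; rewrite !inE /F /=; first by move=> i; rewrite eqxx.
  move=> Fx Fy i; have [xi0|/Fx//] := eqVneq (x i) 0.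
  have [yi0|/Fy//] := eqVneq (y i) 0.
  by change (x i - y i != 0 -> range b i); rewrite xi0 yi0 subr0 eqxx.
have /choice[X XP] (c : {ffun 'I_k -> K}) : exists x : dsum I K,
    (forall j, x (b j) = c j) /\ F x by exact: dsum_interpolation.
have Tcard n :
    #|` fset_set (trajectory (gshift K lam_fin) F n)| = (#|K| ^ (n * k))%N.
  pose Phi (c : {ffun 'I_n * 'I_k -> K}) :=
    \sum_(t < n) iter t (gshift K lam_fin) (X [ffun j => c (t, j)]).
  have -> : trajectory (gshift K lam_fin) F n = range Phi.
    apply/seteqP; split=> [_ [x Fx <-]|_ [c _ <-]]; last first.
      by exists (fun t => X [ffun j => c (t, j)]) => // t; exact: (XP _).2.
    exists [ffun p => x p.1 (b p.2)] => //; apply: eq_bigr => t _.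
    congr (iter _ _ _); have [Xb FX] := XP [ffun j => [ffun p => x p.1 (b p.2)] (t, j)].
    by apply: F_ext => // j; rewrite Xb !ffunE.
  rewrite card_fset_set_range; first by rewrite card_ffun card_prod !card_ord.
  move=> c d cd; suff cdE (r : 'I_n) j : c (r, j) = d (r, j).
    by apply/ffunP => -[r j].
  (* Induction on [n - r]: the coefficients at times later than [r] agree. *)
  have [s] := ubnP (n - r); elim: s => // s IH in r j *; rewrite ltnS => ns.
  have back t p : iter t lam (m j (t + p)%N) = m j p.
    by elim: t => // t IHt; rewrite addSn iterSr (mstr j).2.
  have := congr1 (fun y : dsum I K => y (m j r)) cd.
  rewrite !trajectoryE (bigD1 r) //= [RHS](bigD1 r) //=.
  rewrite -{2 5}[r : nat]addn0 !back !(XP _).1 !ffunE.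
  rewrite (_ : \sum_(t | t != r) _ = \sum_(t < n | t != r)
      X [ffun l => d (t, l)] (iter t lam (m j r))); first exact: addIr.
  apply: eq_bigr => t tr; have [rt|] := ltnP r t.
    by congr (X _ _); apply/ffunP => l; rewrite !ffunE; apply: IH; have := ltn_ord t; lia.
  rewrite leq_eqVlt (negPf (tr : (t : nat) != r)) /= => {}tr.
  rewrite -(subnKC (ltnW tr)) back.
  have nb : ~ range b (m j (r - t)%N).
    move=> [l _ e]; have lj := mdisj _ _ _ _ e; move: e; rewrite lj.
    by move/(mstr j).1; lia.
  by rewrite !(contra_not_eq ((XP _).2 _) nb).
rewrite /trajectory_entropy; apply: lim_near_cst => //; near=> n.
have n0 : n%:R != 0 :> R by rewrite pnatr_eq0 -lt0n; near: n; exact: nbhs_infty_gt.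
rewrite Tcard natrX lnXn ?ltr0n; last by apply/card_gt0P; exists 0.
by rewrite -[_ *+ _]mulr_natl natrM mulrC -mulrA mulKf.
Unshelve. all: by end_near. Qed.

(** * The entropy of a generalized shift *)

Theorem theorem4p14 (R : realType) (Gamma : Type) (lam : Gamma -> Gamma)
    (lam_fin : forall i : Gamma, finite_set (lam @^-1` [set i]))
    (K : finZmodType) (K_nontrivial : (1 < #|K|)%N) :
  ent R (gshift K lam_fin) =
  (card_star R (string_number lam) * (ln (#|K|%:R : R))%:E)%E.
Proof.
have lnK : 0 < ln (#|K|%:R : R) by rewrite ln_gt0 // ltr1n.
have ent_ge k : `I_k #<= string_number lam ->
    ((k%:R * ln (#|K|%:R : R))%:E <= ent R (gshift K lam_fin))%E.
  move=> /string_system_exists[m /(string_system_entropy R lam_fin K)[F Ffin <-]].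
  by apply: ereal_sup_ubound; exists F.
have ent_le F : finite_subgroup F -> exists2 k, `I_k #<= string_number lam &
    trajectory_entropy R (gshift K lam_fin) F <= k%:R * ln (#|K|%:R : R).
  move=> [Ffin _]; pose S := \bigcup_(x in F) supp x.
  have Sfin : finite_set S by apply: bigcup_finite => // x _; exact/asboolP/dsum_fin.
  have [N [a [ainj aS]]] := finite_set_enum Sfin.
  have [|k [C [ks Tle]]] := @trajectory_card_le _ _ lam_fin K _ _ F ainj.
    by move=> x i Fx xi; rewrite aS; exists x.
  by exists k => //; apply: trajectory_entropy_le Tle; exact: ltnW.
rewrite /card_star; case: asboolP => sfin.
  set k := #|` _|; have sk : string_number lam #= `I_k.
    have /finite_setP[n sn] := sfin; by rewrite /k (@card_fset_set {classic nat -> Gamma} _ _ sn).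
  apply/eqP; rewrite -EFinM eq_le; apply/andP; split.
    apply: ge_ereal_sup => _ [F /ent_le[l ls Fl] <-]; rewrite lee_fin.
    apply: le_trans Fl _; rewrite ler_pM2r // ler_nat.
    by rewrite -card_le_II -(card_le_eqr sk).
  by apply: ent_ge; rewrite (card_le_eqr sk).
rewrite gt0_mulye ?lte_fin //; apply/eqyP => r r0.
have [k rk] : exists k : nat, r / ln #|K|%:R <= k%:R.
  by exists (Num.truncn (r / ln #|K|%:R)).+1; exact/ltW/truncnS_gt.
apply: le_trans (ent_ge k _); first by rewrite lee_fin -ler_pdivrMr.
by apply: card_le_trans (card_leT _) _; exact/infiniteP.
Qed.
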